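(* Let $\mathfrak a$ be an Itô B*-algebra with positive functional $l$, death $\theta$ and semi-norms $\|\cdot\|,\ \|\cdot\|_+,\ \|\cdot\|^-,\ \|\cdot\|_+^-$. Let $\mathfrak n^-=\{b\in\mathfrak a:\|b\|^-=0\}$, $\mathfrak n_+=\{c\in\mathfrak a:\|c\|_+=0\}$, and let $\mathfrak d=\mathfrak k_+\cap\mathfrak k^-$, where $\mathfrak k_+=\{a\in\mathfrak a: l(ab^\star)=0\ \forall b\in\mathfrak n_+\}$ and $\mathfrak k^-=\{a\in\mathfrak a: l(a^\star b)=0\ \forall b\in\mathfrak n^-\}$. Suppose that the involution $\star$ restricted to $\mathfrak d$ is left (or right) closable. Then there are a quantum Brownian B*-algebra $\mathfrak b\subseteq\mathfrak a$ and a quantum Lévy B*-algebra $\mathfrak c\subseteq\mathfrak a$ such that $\mathfrak a$ is their orthogonal sum: $$\mathfrak a=\mathfrak b+\mathfrak c,\qquad bc=0\quad\text{for all } b\in\mathfrak b,\ c\in\mathfrak c .$$ Here $\mathfrak b$ and $\mathfrak c$ are $\star$-subalgebras of $\mathfrak a$ containing $\theta$, considered with the involution, functional $l$ and semi-norms restricted from $\mathfrak a$.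
   Context: **Itô B*-algebra.** An Itô B*-algebra is an associative (in general infinite-dimensional, non-commutative, non-unital) complex algebra $\mathfrak a$ with a conjugate-linear involution $a\mapsto a^\star$, $a^{\star\star}=a$, $(ab)^\star=b^\star a^\star$, together with: - a self-adjoint annihilator $\theta=\theta^\star\in\mathfrak a$ (called death), $a\theta=0=\theta a$ for all $a\in\mathfrak a$; - a linear functional $l:\mathfrak a\to\mathbb C$ with $l(a^\star)=\overline{l(a)}$, $l(a^\star a)\ge 0$ for all $a$, and $l(\theta)=1$. The functional $l$ defines four semi-norms $$\|a\|_+^-=|l(a)|,\quad \|a\|^-=l(aa^\star)^{1/2},\quad \|a\|_+=l(a^\star a)^{1/2},\quad \|a\|=\sup\{|l(c'ac)|/(\|c'\|^-\|c\|_+): c',c\in\mathfrak a\}$$ (supremum over $c',c$ with non-zero denominators). It is required that $\|a\|<\infty$ for all $a$, that the four semi-norms jointly separate points of $\mathfrak a$, that $\mathfrak a$ is complete in the uniform topology induced jointly by the four semi-norms, and that the following hold: - $\|a^\star\|=\|a\|$, $\|a^\star\|_+=\|a\|^-$, $\|a^\star\|_+^-=\|a\|_+^-$; - $\|ac\|\le\|a\|\|c\|$, $\|ac\|_+\le\|a\|\|c\|_+$, $\|ac\|^-\le\|a\|^-\|c\|$, $\|ac\|_+^-\le\|a\|^-\|c\|_+$; - $\|a^\star a\|=\|a^\star\|\|a\|$ and $\|a^\star a\|_+^-=\|a^\star\|^-\|a\|_+$. The semi-norms $\|\cdot\|_+$ (left) and $\|\cdot\|^-$ (right) are called the Hilbert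 semi-norms; they come from the semi-inner products $\langle a|b\rangle_+=l(a^\star b)$ and $\langle a|b\rangle^-=l(ab^\star)$. The set $\mathfrak d=\mathfrak k_+\cap\mathfrak k^-$ (the orthogonal complement of $\mathfrak n^-\cup\mathfrak n_+$, in the sense that $a\in\mathfrak d$ iff $l(ab^\star)=0$ for all $b\in\mathfrak n_+$ and $l(a^\star b)=0$ for all $b\in\mathfrak n^-$) is $\star$-invariant. **Closable involution.** The involution restricted to $\mathfrak d$ is left closable if for every sequence $(a_n)$ in $\mathfrak d$ that is Cauchy with respect to both Hilbert semi-norms, $\|a_n\|_+\to0$ implies $\|a_n\|^-\to0$. It is right closable if for every such sequence $\|a_n\|^-\to0$ implies $\|a_n\|_+\to0$. **Brownian and Lévy algebras.** A quantum Brownian B*-algebra is an Itô B*-algebra $\mathfrak b$ whose involution, restricted to the set $\mathfrak d$ formed in $\mathfrak b$ (that is, with $\mathfrak b$ in place of $\mathfrak a$ in the definitions of $\mathfrak n^-$, $\mathfrak n_+$, $\mathfrak k_+$, $\mathfrak k^-$ and $\mathfrak d=\mathfrak k_+\cap\mathfrak k^-$), is left closable (equivalently, by $\star$-invariance of $\mathfrak d$, right closable), i.e. for every sequence $(a_n)$ in this $\mathfrak d$ that is Cauchy with respect to both Hilbert semi-norms, $\|a_n\|_+\to0$ implies $\|a_n\|^-\to0$, and on which the semi-norm $\|\cdot\|$ is identically zero. A quantum Lévy B*-algebra is an Itô B*-algebra $\mathfrak c$ whose involution, restricted to the set $\mathfrak d$ formed in the same way in $\mathfrak c$ (with $\mathfrak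 c$ in place of $\mathfrak a$), is left closable (equivalently, right closable), i.e. for every sequence $(a_n)$ in this $\mathfrak d$ that is Cauchy with respect to both Hilbert semi-norms, $\|a_n\|_+\to0$ implies $\|a_n\|^-\to0$, and in which the linear span $\mathfrak c\mathfrak c$ of all products is dense in $\mathfrak c$ with respect to each of the Hilbert semi-norms $\|\cdot\|_+$, $\|\cdot\|^-$. *)

(* Defs.v *)
From HB Require Import structures.
From mathcomp Require Import all_boot all_order all_algebra.
From mathcomp Require Import all_classical all_reals all_analysis.
From mathcomp Require Import complex.

Set Implicit Arguments.
Unset Strict Implicit.
Unset Printing Implicit Defensive.

Import Order.TTheory GRing.Theory Num.Theory.
Import numFieldNormedType.Exports.

Local Open Scope classical_set_scope.
Local Open Scope ring_scope.

(* MathComp rings are unital, hence a separate structure for associative,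
   not necessarily unital, *-algebras. *)
HB.mixin Record isStarAlgebra (C : numClosedFieldType) A
    of GRing.Lmodule C A := {
  amul : A -> A -> A;
  star : A -> A;
  amulA : forall x y z, amul x (amul y z) = amul (amul x y) z;
  amulDl : forall x y z, amul (x + y) z = amul x z + amul y z;
  amulDr : forall x y z, amul x (y + z) = amul x y + amul x z;
  amulZl : forall (k : C) x y, amul (k *: x) y = k *: amul x y;
  amulZr : forall (k : C) x y, amul x (k *: y) = k *: amul x y;
  starD : forall x y, star (x + y) = star x + star y;
  starZ : forall (k : C) x, star (k *: x) = k^* *: star x;
  starK : forall x, star (star x) = x;
  starM : forall x y, star (amul x y) = amul (star y) (star x)
}.

#[short(type="starAlgType")]
HB.structure Definition StarAlgebra (C : numClosedFieldType) :=
  {A of GRing.Lmodule C A & isStarAlgebra C A}.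

Notation "x ** y" := (amul x y) (at level 40, left associativity) : ring_scope.

Section ItoAlgebra.
Context {R : realType} {A : starAlgType R[i]}.
Implicit Types (l : {scalar A}) (theta : A) (S D : set A).

Definition star_subalgebra S :=
  [/\ S 0,
      forall (k : R[i]) x y, S x -> S y -> S (k *: x + y),
      forall x y, S x -> S y -> S (x ** y) &
      forall x, S x -> S (star x)].

(* The real-valued semi-norms |a|_+^-, |a|_+ and |a|^-.  The values
   l (a^* a) and l (a a^* ) are nonnegative, so Re loses nothing. *)
Definition norm_pm l (a : A) : R := complex.Re `|l a|.
Definition norm_p l (a : A) : R := Num.sqrt (complex.Re (l (star a ** a))).
Definition norm_m l (a : A) : R := Num.sqrt (complex.Re (l (a ** star a))).

(* The notions below are relative to a set S of elements, so that they apply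
   both to a whole algebra (S = setT) and to its subalgebras. *)
Definition norm_ratios l S (a : A) : set R :=
  [set r | exists c' c, [/\ S c', S c, norm_m l c' != 0, norm_p l c != 0 &
     r = complex.Re `|l (c' ** a ** c)| / (norm_m l c' * norm_p l c)]].

(* sup set0 = 0, so this is 0 when there are no nonzero denominators;
   finiteness of the supremum is a separate requirement in [ito_bstar]. *)
Definition opnorm l S (a : A) : R := sup (norm_ratios l S a).

Definition ito_ball l S (e : R) (a b : A) :=
  [/\ opnorm l S (a - b) < e, norm_p l (a - b) < e,
      norm_m l (a - b) < e & norm_pm l (a - b) < e].

(* Completeness of S in the uniform structure of the four semi-norms: every
   Cauchy filter on S, i.e. proper filter with arbitrarily small members
   contained in S, converges to a point of S. *)
Definition ito_complete l S :=
  forall F : set_system A, ProperFilter F ->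
    (forall e : R, 0 < e -> exists X : set A,
       [/\ F X, X `<=` S & forall a b, X a -> X b -> ito_ball l S e a b]) ->
    exists2 a, S a & forall e : R, 0 < e -> F [set b | ito_ball l S e a b].

(* S is an Ito B*-algebra for the operations, death theta and functional l
   restricted to S. *)
Record ito_bstar theta l S : Prop := ItoBstar {
  ito_subalg : star_subalgebra S;
  ito_death_mem : S theta;
  ito_death_star : star theta = theta;
  ito_death_r : forall a, S a -> a ** theta = 0;
  ito_death_l : forall a, S a -> theta ** a = 0;
  ito_lstar : forall a, S a -> l (star a) = (l a)^*;
  ito_lpos : forall a, S a -> 0 <= l (star a ** a);
  ito_ldeath : l theta = 1;
  ito_opnorm_fin : forall a, S a -> has_ubound (norm_ratios l S a);
  ito_separated : forall a, S a -> opnorm l S a = 0 -> norm_p l a = 0 ->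
    norm_m l a = 0 -> norm_pm l a = 0 -> a = 0;
  ito_completeness : ito_complete l S;
  ito_opnorm_star : forall a, S a -> opnorm l S (star a) = opnorm l S a;
  ito_norm_p_star : forall a, S a -> norm_p l (star a) = norm_m l a;
  ito_norm_pm_star : forall a, S a -> norm_pm l (star a) = norm_pm l a;
  ito_opnormM : forall a c, S a -> S c ->
    opnorm l S (a ** c) <= opnorm l S a * opnorm l S c;
  ito_norm_pM : forall a c, S a -> S c ->
    norm_p l (a ** c) <= opnorm l S a * norm_p l c;
  ito_norm_mM : forall a c, S a -> S c ->
    norm_m l (a ** c) <= norm_m l a * opnorm l S c;
  ito_norm_pmM : forall a c, S a -> S c ->
    norm_pm l (a ** c) <= norm_m l a * norm_p l c;
  ito_opnorm_cstar : forall a, S a ->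
    opnorm l S (star a ** a) = opnorm l S (star a) * opnorm l S a;
  ito_norm_pm_cstar : forall a, S a ->
    norm_pm l (star a ** a) = norm_m l (star a) * norm_p l a
}.

Definition null_m l S : set A := [set b | S b /\ norm_m l b = 0].
Definition null_p l S : set A := [set c | S c /\ norm_p l c = 0].
Definition k_p l S : set A :=
  [set a | S a /\ forall b, null_p l S b -> l (a ** star b) = 0].
Definition k_m l S : set A :=
  [set a | S a /\ forall b, null_m l S b -> l (star a ** b) = 0].
Definition d_set l S : set A := k_p l S `&` k_m l S.

Definition cauchy_for (p : A -> R) (a : nat -> A) :=
  forall e : R, 0 < e ->
    exists N, forall m n, (N <= m)%N -> (N <= n)%N -> p (a m - a n) < e.

Definition left_closable l D :=
  forall a : nat -> A, (forall n, D (a n)) ->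
    cauchy_for (norm_p l) a -> cauchy_for (norm_m l) a ->
    norm_p l (a n) @[n --> \oo] --> (0 : R) ->
    norm_m l (a n) @[n --> \oo] --> (0 : R).

Definition right_closable l D :=
  forall a : nat -> A, (forall n, D (a n)) ->
    cauchy_for (norm_p l) a -> cauchy_for (norm_m l) a ->
    norm_m l (a n) @[n --> \oo] --> (0 : R) ->
    norm_p l (a n) @[n --> \oo] --> (0 : R).

Definition product_span S : set A :=
  [set z | exists n (k : 'I_n -> R[i]) (x y : 'I_n -> A),
     (forall i, S (x i) /\ S (y i)) /\ z = \sum_(i < n) k i *: (x i ** y i)].

Definition dense_for (p : A -> R) (D S : set A) :=
  forall a, S a -> forall e : R, 0 < e -> exists2 z, D z & p (a - z) < e.

Definition quantum_brownian theta l S :=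
  [/\ ito_bstar theta l S, left_closable l (d_set l S) &
      forall a, S a -> opnorm l S a = 0].

Definition quantum_levy theta l S :=
  [/\ ito_bstar theta l S, left_closable l (d_set l S),
      dense_for (norm_p l) (product_span S) S &
      dense_for (norm_m l) (product_span S) S].

End ItoAlgebra.

(* Main.v *)
Require Import Defs.
From HB Require Import structures.
From mathcomp Require Import all_boot all_order all_algebra.
From mathcomp Require Import all_classical all_reals all_analysis.
From mathcomp Require Import complex ring lra.

(* Let B consist of the b with zero operator semi-norm for which all |a b|_+
   and |b a|^- vanish, and C of the c such that c and c^* are limits, for the
   left Hilbert semi-norm, of sums of products.  Cauchy-Schwarz and separation
   give BC = CB = 0, so |b + c|^2 = |b|^2 + |c|^2; hence semi-norms and the set
   d formed in B or C agree with, respectively lie in, those of A.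

   The decomposition A = B + C takes two steps.  For a = a^* and small s > 0 the
   elements r_n = (1 - s a^2)^(2n) a satisfy |r_n x| <= (2 s n)^(-1/2) |x|;
   their inner products depend only on m + n and decrease, so (r_n) is Cauchy
   for all semi-norms; its limit b has zero operator semi-norm, and a - r_n is a
   product.
   Next, if b has zero operator semi-norm, project b orthogonally on the closure
   of A b, and b^* on that of A b^*, along sequences x_n b and y_n b^*.  The
   elements x_n b + b y_n^* are Cauchy, since the left semi-norm ignores the
   second term and the right one the first; their limit lies in C and differs
   from b by an element of B. *)

Set Implicit Arguments.
Unset Strict Implicit.
Unset Printing Implicit Defensive.

Import Order.TTheory GRing.Theory Num.Theory.
Import numFieldNormedType.Exports.

Local Open Scope classical_set_scope.
Local Open Scope ring_scope.

(** * Linear identities in non-unital star-algebras *)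

Section StarAlgebraTheory.
Context {C : numClosedFieldType} {A : starAlgType C}.
Implicit Types x y : A.

Lemma amul0l x : 0 ** x = 0.
Proof. by have := amulZl 0 x x; rewrite !scale0r. Qed.

Lemma amul0r x : x ** 0 = 0.
Proof. by have := amulZr 0 x x; rewrite !scale0r. Qed.

Lemma amulNl x y : (- x) ** y = - (x ** y).
Proof. by rewrite -(scaleN1r x) amulZl scaleN1r. Qed.

Lemma amulNr x y : x ** (- y) = - (x ** y).
Proof. by rewrite -(scaleN1r y) amulZr scaleN1r. Qed.

Lemma amulBl x y z : (x - y) ** z = x ** z - y ** z.
Proof. by rewrite amulDl amulNl. Qed.

Lemma amulBr x y z : x ** (y - z) = x ** y - x ** z.
Proof. by rewrite amulDr amulNr. Qed.

Lemma star0 : star 0 = 0 :> A.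
Proof. by have := starZ 0 (0 : A); rewrite conjC0 !scale0r. Qed.

Lemma starN x : star (- x) = - star x.
Proof. by rewrite -(scaleN1r x) starZ rmorphN1 scaleN1r. Qed.

Lemma starB x y : star (x - y) = star x - star y.
Proof. by rewrite starD starN. Qed.

Lemma amul_sumr I (r : seq I) (F : I -> A) x :
  x ** \sum_(i <- r) F i = \sum_(i <- r) x ** F i.
Proof. exact: (big_morph _ (amulDr x) (amul0r x)). Qed.

Lemma star_sum I (r : seq I) (F : I -> A) :
  star (\sum_(i <- r) F i) = \sum_(i <- r) star (F i).
Proof. exact: (big_morph _ (@starD _ A) star0). Qed.

End StarAlgebraTheory.

(** * Real parts and moduli of complex numbers *)

Section ComplexReal.
Context {R : rcfType}.
Implicit Types (k : R) (u v : R[i]).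

Lemma ReD u v : complex.Re (u + v) = complex.Re u + complex.Re v.
Proof. by case: u; case: v. Qed.

Lemma ReN u : complex.Re (- u) = - complex.Re u.
Proof. by case: u. Qed.

Lemma ReZ k u : complex.Re (k%:C%C * u) = k * complex.Re u.
Proof. by case: u => u v /=; rewrite mul0r subr0. Qed.

Lemma ReJ u : complex.Re (u^*) = complex.Re u.
Proof. by case: u. Qed.

Lemma conj_realC k : (k%:C%C)^* = k%:C%C :> R[i].
Proof. by rewrite conj_Creal // complex_real. Qed.

Lemma Re_norm_ge0 u : 0 <= complex.Re `|u|.
Proof. by rewrite normc_def /= sqrtr_ge0. Qed.

Lemma Re_le_norm u : `|complex.Re u| <= complex.Re `|u|.
Proof. by have := normc_ge_Re u; rewrite lecE => /andP[]. Qed.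

End ComplexReal.

(** * Numbers bounded by arbitrarily small ones *)

Section SmallBounds.
Context {R : realFieldType}.
Implicit Types x M e : R.

Lemma le0_eps x M : (forall e, 0 < e -> x <= M * e) -> x <= 0.
Proof.
move=> xM; rewrite leNgt; apply/negP => x0.
have M1 : 0 < 2 * (`|M| + 1) by rewrite mulr_gt0 // ltr_wpDl.
(* With this [e] the product [M * e] is at most [x / 2]. *)
have := xM (x / (2 * (`|M| + 1))) (divr_gt0 x0 M1).
rewrite mulrA ler_pdivlMr // => h.
have : M * x <= `|M| * x by rewrite ler_wpM2r ?ler_norm // ltW.
have Mx0 : 0 <= `|M| * x by rewrite mulr_ge0 // ltW.
by rewrite mulrDr in h; nra.
Qed.

Lemma norm0_eps x M : (forall e, 0 < e -> `|x| <= M * e) -> x = 0.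
Proof. by move=> /le0_eps; rewrite normr_le0 => /eqP. Qed.

Lemma eq0_eps x : 0 <= x -> (forall e, 0 < e -> x <= e) -> x = 0.
Proof.
move=> x0 xe; apply: le_anti; rewrite x0 andbT.
by apply: (le0_eps (M := 1)) => e e0; rewrite mul1r xe.
Qed.

End SmallBounds.

(** * The Hilbert and operator semi-norms *)

Section Decomposition.
Context {R : realType} {A : starAlgType R[i]} (theta : A) (l : {scalar A}).
Hypothesis itoA : ito_bstar theta l [set: A].

Local Notation op := (opnorm l [set: A]).
Local Notation np := (norm_p l).
Local Notation nm := (norm_m l).
Local Notation npm := (norm_pm l).
Local Notation "k %:C" := (real_complex_def (Phant R) k) : ring_scope.

(** The real part of the left semi-inner product. It is symmetric and real-bilinear, and [ip x x] is
    still the full square of [np x]. *)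
Definition ip (x y : A) : R := complex.Re (l (star x ** y)).

Implicit Types x y z a b c : A.

Lemma lD x y : l (x + y) = l x + l y. Proof. exact: raddfD. Qed.
Lemma lN x : l (- x) = - l x. Proof. exact: raddfN. Qed.
Lemma lB x y : l (x - y) = l x - l y. Proof. exact: raddfB. Qed.
Lemma lZ k x : l (k *: x) = k * l x. Proof. exact: linearZ. Qed.
Lemma l0 : l 0 = 0. Proof. exact: raddf0. Qed.
Lemma lstar x : l (star x) = (l x)^*. Proof. exact: (ito_lstar itoA). Qed.

Lemma ipDl x y z : ip (x + y) z = ip x z + ip y z.
Proof. by rewrite /ip starD amulDl lD ReD. Qed.
Lemma ipDr x y z : ip x (y + z) = ip x y + ip x z.
Proof. by rewrite /ip amulDr lD ReD. Qed.
Lemma ipNl x y : ip (- x) y = - ip x y.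
Proof. by rewrite /ip starN amulNl lN ReN. Qed.
Lemma ipNr x y : ip x (- y) = - ip x y.
Proof. by rewrite /ip amulNr lN ReN. Qed.
Lemma ipZl k x y : ip (k%:C *: x) y = k * ip x y.
Proof. by rewrite /ip starZ conj_realC amulZl lZ ReZ. Qed.
Lemma ipZr k x y : ip x (k%:C *: y) = k * ip x y.
Proof. by rewrite /ip amulZr lZ ReZ. Qed.
Lemma ipC x y : ip x y = ip y x.
Proof. by rewrite /ip -[star y ** x]starK lstar ReJ starM starK. Qed.
Definition ipE := (ipDl, ipDr, ipNl, ipNr, ipZl, ipZr).
Lemma ip_adj a x y : ip (a ** x) y = ip x (star a ** y).
Proof. by rewrite /ip starM amulA. Qed.

Lemma ip_ge0 x : 0 <= ip x x.
Proof. by have := ito_lpos itoA (a := x) I; rewrite lecE => /andP[]. Qed.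

Lemma np_sqr x : np x ^+ 2 = ip x x.
Proof. exact: sqr_sqrtr (ip_ge0 x). Qed.

Lemma np_ge0 x : 0 <= np x. Proof. exact: sqrtr_ge0. Qed.
Lemma nm_ge0 x : 0 <= nm x. Proof. exact: sqrtr_ge0. Qed.
Lemma npm_ge0 x : 0 <= npm x. Proof. exact: Re_norm_ge0. Qed.

Hint Resolve np_ge0 nm_ge0 npm_ge0 : core.

Lemma np_star x : np (star x) = nm x. Proof. exact: (ito_norm_p_star itoA). Qed.
Lemma nm_star x : nm (star x) = np x. Proof. by rewrite -np_star starK. Qed.

Lemma cauchy_schwarz x y : npm (x ** y) <= nm x * np y.
Proof. exact: (ito_norm_pmM itoA). Qed.

Lemma ip_le x y : `|ip x y| <= np x * np y.
Proof.
rewrite -[np x]nm_star; apply: le_trans (cauchy_schwarz _ _).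
exact: Re_le_norm.
Qed.

Lemma np_le x M : 0 <= M -> ip x x <= M ^+ 2 -> np x <= M.
Proof. by move=> M0; rewrite -np_sqr ler_pXn2r ?nnegrE. Qed.

Lemma npD x y : np (x + y) <= np x + np y.
Proof.
apply: np_le; first by rewrite addr_ge0.
have := le_trans (ler_norm _) (ip_le x y).
by rewrite !ipE (ipC y x) sqrrD !np_sqr; lra.
Qed.

Lemma npZ (k : R[i]) x : np (k *: x) = complex.Re `|k| * np x.
Proof.
apply/eqP; rewrite -(@eqrXn2 _ 2) ?mulr_ge0 ?Re_norm_ge0 // exprMn !np_sqr.
rewrite /ip starZ amulZl amulZr scalerA lZ -normCKC.
have {1}-> : `|k| = (complex.Re `|k|)%:C by rewrite RRe_real ?normr_real.
by rewrite -rmorphXn ReZ.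
Qed.

Lemma npN x : np (- x) = np x.
Proof. by rewrite /norm_p starN amulNl amulNr opprK. Qed.
Lemma npB x y : np (x - y) <= np x + np y.
Proof. by rewrite -[np y]npN npD. Qed.
Lemma np_distC x y : np (x - y) = np (y - x).
Proof. by rewrite -npN opprB. Qed.
Lemma np0 : np 0 = 0.
Proof. by rewrite /norm_p amul0r l0 sqrtr0. Qed.

Lemma nmD x y : nm (x + y) <= nm x + nm y.
Proof. by rewrite -!np_star starD npD. Qed.
Lemma nmN x : nm (- x) = nm x.
Proof. by rewrite -!np_star starN npN. Qed.
Lemma nm0 : nm 0 = 0. Proof. by rewrite -np_star star0 np0. Qed.

Lemma npm_eq0 x : npm x = 0 -> l x = 0.
Proof.
move=> h; apply/eqP; rewrite -normr_eq0; apply/eqP.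
by rewrite -[LHS]RRe_real ?normr_real // -/(npm x) h.
Qed.

Lemma l_amul0 x y : nm x * np y = 0 -> l (x ** y) = 0.
Proof.
by move=> h; apply: npm_eq0; apply/eqP; rewrite eq_le npm_ge0 -h cauchy_schwarz.
Qed.

Lemma opS_ge0 S x : 0 <= opnorm l S x.
Proof.
rewrite /opnorm; have [->|/set0P[r Sr]] := eqVneq (norm_ratios l S x) set0.
  by rewrite sup0.
have ratio_ge0 s : norm_ratios l S x s -> 0 <= s.
  by move=> [c' [c [_ _ _ _ ->]]]; rewrite divr_ge0 ?mulr_ge0 ?Re_norm_ge0.
have [ubS|nubS] := pselect (has_ubound (norm_ratios l S x)).
  exact: le_trans (ratio_ge0 _ Sr) (ub_le_sup ubS Sr).
(* Without an upper bound [sup] takes its default value 0. *)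
by rewrite sup_out // => -[].
Qed.

Lemma opS_le S x (M : R) : 0 <= M ->
  (forall c', S c' -> forall c, S c ->
    npm (c' ** x ** c) <= M * (nm c' * np c)) ->
  opnorm l S x <= M.
Proof.
move=> M0 xM; rewrite /opnorm.
have [->|/set0P Sr] := eqVneq (norm_ratios l S x) set0.
  by rewrite sup0.
apply: ge_sup => // _ [c' [c [Sc' Sc c'0 c0 ->]]].
by rewrite ler_pdivrMr ?xM // mulr_gt0 // lt_neqAle eq_sym ?c'0 ?c0 /=.
Qed.

Lemma op_ge0 x : 0 <= op x. Proof. exact: opS_ge0. Qed.
Hint Resolve op_ge0 : core.

Lemma np_amul a x : np (a ** x) <= op a * np x.
Proof. exact: (ito_norm_pM itoA). Qed.

Lemma nm_amul x a : nm (x ** a) <= nm x * op a.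
Proof. exact: (ito_norm_mM itoA). Qed.

Lemma op_amul a b : op (a ** b) <= op a * op b.
Proof. exact: (ito_opnormM itoA). Qed.

Lemma op_star a : op (star a) = op a.
Proof. exact: (ito_opnorm_star itoA). Qed.

(** Cauchy-Schwarz for the product of [c'] and [a ** c]. Together with [np_amul] it makes [op a] the
    operator norm of left multiplication by [a] with respect to [np]. *)
Lemma op_le a M : 0 <= M -> (forall x, np (a ** x) <= M * np x) -> op a <= M.
Proof.
move=> M0 aM; apply: opS_le => // c' _ c _; rewrite -amulA.
apply: le_trans (cauchy_schwarz _ _) _.
by rewrite mulrCA ler_wpM2l.
Qed.

Lemma opD a b : op (a + b) <= op a + op b.
Proof.
apply: op_le => [|x]; first by rewrite addr_ge0.
rewrite amulDl mulrDl; apply: le_trans (npD _ _) _.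
by rewrite lerD ?np_amul.
Qed.

Lemma opN a : op (- a) = op a.
Proof.
suff H b : op (- b) <= op b by apply/le_anti; rewrite H -{1}[a]opprK H.
by apply: op_le => // x; rewrite amulNl npN np_amul.
Qed.

Lemma op_eq0P a : op a = 0 <-> forall x, np (a ** x) = 0.
Proof.
split=> [a0 x|ax0]; apply: le_anti.
  by rewrite np_ge0 (le_trans (np_amul a x)) // a0 mul0r.
by rewrite op_ge0 op_le // => x; rewrite ax0 mul0r.
Qed.

Lemma amul_theta a : a ** theta = 0. Proof. exact: (ito_death_r itoA). Qed.
Lemma theta_amul a : theta ** a = 0. Proof. exact: (ito_death_l itoA). Qed.
Lemma star_theta : star theta = theta. Proof. exact: (ito_death_star itoA). Qed.

Lemma np_theta k : np (k *: theta) = 0.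
Proof. by rewrite /norm_p amulZr amul_theta scaler0 l0 sqrtr0. Qed.

Lemma nm_theta k : nm (k *: theta) = 0.
Proof. by rewrite /norm_m amulZl theta_amul scaler0 l0 sqrtr0. Qed.

Lemma op_theta k : op (k *: theta) = 0.
Proof. by apply/op_eq0P => x; rewrite amulZl theta_amul scaler0 np0. Qed.

Lemma l_theta : l theta = 1. Proof. exact: (ito_ldeath itoA). Qed.

Lemma op_shift a k : op (a + k *: theta) <= op a.
Proof. by rewrite -[leRHS]addr0 -(op_theta k) opD. Qed.

Lemma np_shift a k : np (a + k *: theta) <= np a.
Proof. by rewrite -[leRHS]addr0 -(np_theta k) npD. Qed.

Lemma nm_shift a k : nm (a + k *: theta) <= nm a.
Proof. by rewrite -[leRHS]addr0 -(nm_theta k) nmD. Qed.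

(* Subtracting multiples of the death makes [l] vanish along the sequence
   without changing the three other semi-norms. *)
Lemma ito_limit (x : nat -> A) :
  cauchy_for op x -> cauchy_for np x -> cauchy_for nm x ->
  exists a, forall e : R, 0 < e -> exists N, forall n, (N <= n)%N ->
    [/\ op (x n - a) < e, np (x n - a) < e & nm (x n - a) < e].
Proof.
move=> xo xp xm; pose y n := x n - l (x n) *: theta.
have ly n : l (y n) = 0 by rewrite lB lZ l_theta mulr1 subrr.
have yB m n : y m - y n = (x m - x n) + (l (x n) - l (x m)) *: theta.
  by rewrite scalerBl /y opprB addrACA [RHS]addrACA [- x n - _]addrC.
have [e e0|a _ ya] := ito_completeness itoA (F := y @ \oo).
  have [N1 xo1] := xo _ e0; have [N2 xp2] := xp _ e0; have [N3 xm3] := xm _ e0.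
  exists (y @` [set n | (maxn N1 (maxn N2 N3) <= n)%N]); split=> //.
    by exists (maxn N1 (maxn N2 N3)) => // n /= Nn; exists n.
  move=> _ _ [m /= + <-] [n /= + <-].
  rewrite !geq_max => /and3P[m1 m2 m3] /and3P[n1 n2 n3]; split.
  - by rewrite yB (le_lt_trans (op_shift _ _)) ?xo1.
  - by rewrite yB (le_lt_trans (np_shift _ _)) ?xp2.
  - by rewrite yB (le_lt_trans (nm_shift _ _)) ?xm3.
  - by rewrite /norm_pm lB !ly subrr normr0.
exists a => e e0; have [N _ yN] := ya e e0; exists N => n /yN[/= ao ap am _].
have -> : x n - a = - (a - y n) + l (x n) *: theta.
  by rewrite /y opprB addrAC subrK.
split.
- by rewrite (le_lt_trans (op_shift _ _)) ?opN.
- by rewrite (le_lt_trans (np_shift _ _)) ?npN.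
- by rewrite (le_lt_trans (nm_shift _ _)) ?nmN.
Qed.

(** Ratios over [S] are among those over [A], which gives finiteness. A Cauchy filter on [S]
    converges in [A], and closedness puts its limit in [S]. The other laws are inherited, as the two
    operator semi-norms agree on [S]. *)
Lemma ito_bstar_sub S : star_subalgebra S -> S theta ->
  (forall a, S a -> opnorm l S a = op a) ->
  (forall a, (forall e : R, 0 < e -> exists2 b, S b & ito_ball l setT e a b) ->
    S a) ->
  ito_bstar theta l S.
Proof.
move=> subS Stheta opS closedS.
have [S0 SZD SM Sstar] := subS.
have SB a b : S a -> S b -> S (a - b).
  by move=> Sa Sb; rewrite addrC -scaleN1r; apply: SZD.
have ballS e a b : S a -> S b -> ito_ball l S e a b <-> ito_ball l setT e a b.
  by move=> Sa Sb; rewrite /ito_ball opS //; apply: SB.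
(* In the order of the fields: [h7] is finiteness, [h8] separation, [h9] completeness. *)
case: (itoA) => _ _ h1 h2 h3 h4 h5 h6 h7 h8 h9
  h10 h11 h12 h13 h14 h15 h16 h17 h18.
split=> //.
- by move=> a _; apply: h2.
- by move=> a _; apply: h3.
- by move=> a _; apply: h4.
- by move=> a _; apply: h5.
- move=> a _; have [M aM] := h7 a I; exists M => r [c' [c [_ _ c'0 c0 ->]]].
  by apply: aM; exists c', c.
- by move=> a Sa; rewrite opS //; apply: h8.
- move=> F PF cauchyF.
  have [e e0|a _ Fa] := h9 F PF.
    have [X [FX XS Xe]] := cauchyF e e0; exists X; split=> // a b Xa Xb.
    by apply/ballS; auto.
  (* One member of [F] inside [S] is enough, whence the arbitrary radius 1: it meets every ball
     about [a]. *)
  have [X [FX XS _]] := cauchyF 1 ltr01.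
  have Sa : S a.
    apply: closedS => e e0.
    have [b [Xb ab]] := @filter_ex _ _ PF _ (filterI FX (Fa e e0)).
    by exists b => //; apply: XS.
  exists a => // e e0; apply: filterS (filterI FX (Fa e e0)) => b [Xb ab] /=.
  by apply/ballS; auto.
- by move=> a Sa; rewrite !opS ?h10 //; apply: Sstar.
- by move=> a _; apply: h11.
- by move=> a _; apply: h12.
- by move=> a c Sa Sc; rewrite !opS ?h13 //; apply: SM.
- by move=> a c Sa Sc; rewrite !opS ?h14.
- by move=> a c Sa Sc; rewrite !opS ?h15.
- by move=> a c _ _; apply: h16.
- by move=> a Sa; rewrite !opS ?h17 //; do ?[apply: SM|apply: Sstar].
- by move=> a _; apply: h18.
Qed.

(** * Spans of products *)

Lemma product_span0 (S : set A) : product_span S 0.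
Proof.
exists 0%N, (fun=> 0), (fun=> 0), (fun=> 0).
by split=> [[]//|]; rewrite big_ord0.
Qed.

Lemma product_spanM (S : set A) x y : S x -> S y -> product_span S (x ** y).
Proof.
move=> Sx Sy; exists 1%N, (fun=> 1), (fun=> x), (fun=> y).
by rewrite big_ord1 scale1r.
Qed.

Lemma product_span_lin (S : set A) k x y :
  product_span S x -> product_span S y -> product_span S (k *: x + y).
Proof.
move=> [n [j [u [v [Suv ->]]]]] [n' [j' [u' [v' [Suv' ->]]]]].
pose cat (T : Type) (f : 'I_n -> T) (g : 'I_n' -> T) (i : 'I_(n + n')) :=
  match fintype.split i with inl i1 => f i1 | inr i2 => g i2 end.
exists (n + n')%N, (cat _ (fun i => k * j i) j'), (cat _ u u'), (cat _ v v').
split=> [i|]; first by rewrite /cat; case: (fintype.split i).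
rewrite big_split_ord scaler_sumr; congr (_ + _); apply: eq_bigr => i _.
- by rewrite /cat (unsplitK (inl _ i)) scalerA.
- by rewrite /cat (unsplitK (inr _ i)).
Qed.

Lemma product_span_star S x : (forall y, S y -> S (star y)) ->
  product_span S x -> product_span S (star x).
Proof.
move=> Sstar [n [k [u [v [Suv ->]]]]].
exists n, (fun i => (k i)^*), (star \o v), (star \o u); split=> [i|].
  by have [] := Suv i; split; apply: Sstar.
by rewrite star_sum; apply: eq_bigr => i _; rewrite starZ starM.
Qed.

(** * The Brownian and Levy parts *)

Definition near_products : set A :=
  [set x | forall e : R, 0 < e ->
     exists2 z, product_span setT z & np (x - z) < e].

Lemma near_productsW x : product_span setT x -> near_products x.
Proof. by move=> Px e e0; exists x => //; rewrite subrr np0. Qed.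

Lemma near_products_lin k x y :
  near_products x -> near_products y -> near_products (k *: x + y).
Proof.
(* The added 1 keeps the divisor positive when [k] is 0. *)
move=> Px Py e e0; pose N := complex.Re `|k| + 1.
have N0 : 0 < N by rewrite ltr_wpDl ?Re_norm_ge0.
have e2 : 0 < e / 2 by rewrite divr_gt0.
have [z Pz xz] := Px (e / 2 / N) (divr_gt0 e2 N0).
have [w Pw yw] := Py _ e2.
exists (k *: z + w); first exact: product_span_lin.
rewrite opprD addrACA -scalerBr; apply: le_lt_trans (npD _ _) _.
rewrite npZ [ltRHS]splitr ler_ltD //.
rewrite ltr_pdivlMr // in xz; apply: le_trans (ltW xz).
by rewrite mulrC ler_wpM2l // /N lerDl.
Qed.

Lemma near_products_closed x :
  (forall e : R, 0 < e -> exists2 y, near_products y & np (x - y) < e) ->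
  near_products x.
Proof.
move=> xP e e0; have e2 : 0 < e / 2 by rewrite divr_gt0.
have [y Py xy] := xP _ e2; have [z Pz yz] := Py _ e2.
exists z => //; rewrite -(subrK y x) -addrA; apply: le_lt_trans (npD _ _) _.
by rewrite [ltRHS]splitr ltrD.
Qed.

(** By Cauchy-Schwarz the last two conditions make [b] orthogonal to all products in both semi-inner
    products. The mirror quantities [nm (a ** b)] and [np (b ** a)] vanish as soon as [op b = 0]. *)
Definition brownian_part : set A :=
  [set b | [/\ op b = 0, forall a, np (a ** b) = 0 &
              forall a, nm (b ** a) = 0]].

(** As [nm c] is [np (star c)], the second condition says that [c] is a limit of sums of products
    for the right semi-norm. The approximants for the two semi-norms may differ. *)
Definition levy_part : set A :=
  [set c | near_products c /\ near_products (star c)].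

Lemma levy_part_prod x y : levy_part (x ** y).
Proof. by split; rewrite ?starM; apply/near_productsW/product_spanM. Qed.

Lemma np_lin0 k x y : np x = 0 -> np y = 0 -> np (k *: x + y) = 0.
Proof.
move=> x0 y0; apply: le_anti.
by rewrite np_ge0 (le_trans (npD _ _)) // npZ x0 y0 mulr0 addr0.
Qed.

Lemma brownian_part_star b : brownian_part b -> brownian_part (star b).
Proof.
move=> [b0 bp bm]; split=> [|a|a]; first by rewrite op_star.
- by rewrite -[a]starK -starM np_star bm.
- by rewrite -[a]starK -starM nm_star bp.
Qed.

Lemma brownian_part_subalg : star_subalgebra brownian_part.
Proof.
split=> [|k x y [x0 xp xm] [y0 yp ym]|x y [x0 xp xm] [y0 yp ym]|];
  last exact: brownian_part_star.
- split=> [|a|a]; rewrite ?amul0l ?amul0r ?np0 ?nm0 //.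
  by apply/op_eq0P => a; rewrite amul0l np0.
- split=> [|a|a].
  + apply/op_eq0P => a; rewrite amulDl amulZl.
    by apply: np_lin0; apply: (op_eq0P _).1.
  + by rewrite amulDr amulZr np_lin0.
  + rewrite -np_star amulDl amulZl starD starZ np_lin0 // np_star; auto.
- split=> [|a|a]; apply: le_anti.
  + by rewrite op_ge0 (le_trans (op_amul _ _)) // x0 mul0r.
  + rewrite np_ge0 amulA (le_trans (np_amul _ _)) // (_ : op _ = 0) ?mul0r //.
    by apply: le_anti; rewrite op_ge0 (le_trans (op_amul _ _)) // x0 mulr0.
  + rewrite nm_ge0 -amulA (le_trans (nm_amul _ _)) // (_ : op _ = 0) ?mulr0 //.
    by apply: le_anti; rewrite op_ge0 (le_trans (op_amul _ _)) // y0 mul0r.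
Qed.

Lemma levy_part_subalg : star_subalgebra levy_part.
Proof.
split=> [|k x y [xp xm] [yp ym]|x y _ _|x [xp xm]];
  last by split; rewrite ?starK.
- by split; rewrite ?star0; apply/near_productsW/product_span0.
- by split; rewrite ?starD ?starZ; apply: near_products_lin.
- exact: levy_part_prod.
Qed.

Lemma brownian_part_theta : brownian_part theta.
Proof.
have H := op_theta 1; rewrite scale1r in H.
by split=> // a; rewrite ?amul_theta ?theta_amul ?np0 ?nm0.
Qed.

Lemma levy_part_theta : levy_part theta.
Proof.
have H : near_products theta.
  move=> e e0; exists 0; first exact: product_span0.
  by rewrite subr0 -[theta]scale1r np_theta.
by split; rewrite ?star_theta.
Qed.

Lemma brownian_part_closed a :
  (forall e : R, 0 < e -> exists2 b, brownian_part b & ito_ball l setT e a b) ->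
  brownian_part a.
Proof.
move=> aB; split=> [|z|z]; apply: le_anti.
- rewrite op_ge0 andbT; apply: (le0_eps (M := 1)) => e e0; rewrite mul1r.
  have [b [b0 _ _] [/ltW ab _ _ _]] := aB e e0.
  by rewrite -(subrK b a) (le_trans (opD _ _)) // b0 addr0.
- rewrite np_ge0 andbT; apply: (le0_eps (M := (op z))) => e e0.
  have [b [_ bp _] [_ /ltW ab _ _]] := aB e e0.
  rewrite -(subrK b a) amulDr (le_trans (npD _ _)) // bp addr0.
  by rewrite (le_trans (np_amul _ _)) // ler_wpM2l.
- rewrite nm_ge0 andbT; apply: (le0_eps (M := (op z))) => e e0.
  have [b [_ _ bm] [_ _ /ltW ab _]] := aB e e0.
  rewrite -(subrK b a) amulDl (le_trans (nmD _ _)) // bm addr0.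
  by rewrite (le_trans (nm_amul _ _)) // mulrC ler_wpM2l.
Qed.

Lemma levy_part_closed a :
  (forall e : R, 0 < e -> exists2 b, levy_part b & ito_ball l setT e a b) ->
  levy_part a.
Proof.
move=> aC; split; apply: near_products_closed => e e0.
- by have [b [bp _] [_ ab _ _]] := aC e e0; exists b.
- have [b [_ bm] [_ _ ab _]] := aC e e0; exists (star b) => //.
  by rewrite -starB np_star.
Qed.

(** All four semi-norms of [b ** c] vanish: [op] and [np] because [op b = 0], [nm] by definition of
    the Brownian part. For [l], Cauchy-Schwarz gives [l (b ** x ** y) = 0], and [c] is an [np]-limit
    of sums of products. *)
Lemma mul_brownian_levy b c : brownian_part b -> levy_part c -> b ** c = 0.
Proof.
move=> [b0 bp bm] [cP _]; apply: (ito_separated itoA) => //.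
- by apply: le_anti; rewrite op_ge0 (le_trans (op_amul _ _)) // b0 mul0r.
- by apply: le_anti; rewrite np_ge0 (le_trans (np_amul _ _)) // b0 mul0r.
apply: le_anti; rewrite npm_ge0 andbT; apply: (le0_eps (M := (nm b))) => e e0.
have [z [n [k [x [y [_ zE]]]]] /ltW cz] := cP e e0.
have lz : l (b ** z) = 0.
  rewrite zE amul_sumr raddf_sum big1 //= => i _.
  by rewrite amulZr lZ amulA l_amul0 ?mulr0 // bm mul0r.
rewrite -(subrK z c) amulDr /norm_pm lD lz addr0.
by rewrite (le_trans (cauchy_schwarz _ _)) // ler_wpM2l.
Qed.

Lemma mul_levy_brownian b c : brownian_part b -> levy_part c -> c ** b = 0.
Proof.
move=> Bb Cc; have [_ _ _ Cstar] := levy_part_subalg.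
rewrite -[_ ** _]starK starM mul_brownian_levy ?star0 //.
  exact: brownian_part_star.
exact: Cstar.
Qed.

Lemma ip_amul0 x y : star x ** y = 0 -> ip x y = 0.
Proof. by rewrite /ip => ->; rewrite l0. Qed.

(** * Complementary subalgebras *)

(** Symmetric in [S] and [S'], so that what is shown for the first set applies to the Brownian and
    to the Levy part. *)
Definition complements (S S' : set A) : Prop :=
  [/\ forall a, exists s s', [/\ S s, S' s' & a = s + s'],
      forall s s', S s -> S' s' -> s ** s' = 0,
      forall s s', S s -> S' s' -> s' ** s = 0,
      forall s, S s -> S (star s) &
      forall s', S' s' -> S' (star s')].

Section Complements.
Context {S S' : set A}.
Hypothesis SS' : complements S S'.

(** Pythagoras: [star s' ** s = 0] makes [s] and [s'] orthogonal. *)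
Lemma np_complements s s' : S s -> S' s' -> np s <= np (s + s').
Proof.
move=> Ss Ss'; have [_ _ SS'0 _ starS'] := SS'; apply: np_le => //.
have ss'0 : ip s' s = 0 by apply: ip_amul0; apply: SS'0 => //; apply: starS'.
by rewrite np_sqr !ipE (ipC s s') ss'0 addr0 add0r lerDl ip_ge0.
Qed.

Lemma nm_complements s s' : S s -> S' s' -> nm s <= nm (s + s').
Proof.
have [_ _ _ starS starS'] := SS'.
by move=> Ss Ss'; rewrite -!np_star starD np_complements //; auto.
Qed.

(** Test elements of [A] may be replaced by their components in [S]: the components in [S'] are
    annihilated by [a], and dropping them does not increase the Hilbert semi-norms. *)
Lemma opS_complements a : S a -> opnorm l S a = op a.
Proof.
move=> Sa; have [decS S0 S'0 starS _] := SS'.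
have opS0 := opS_ge0 S a.
apply: le_anti; apply/andP; split; apply: opS_le => // c' _ c _.
  rewrite -amulA; apply: le_trans (cauchy_schwarz _ _) _.
  by rewrite mulrCA ler_wpM2l // np_amul.
have [t [t' [St St' ->]]] := decS c'; have [s [s' [Ss Ss' ->]]] := decS c.
have -> : (t + t') ** a ** (s + s') = t ** a ** s.
  rewrite amulDl (S'0 a t') // addr0 amulDr -[_ ** s']amulA (S0 a s') //.
  by rewrite amul0r addr0.
apply: le_trans (_ : opnorm l S a * (nm t * np s) <= _); last first.
  by rewrite ler_wpM2l // ler_pM // ?nm_complements ?np_complements.
(* A zero denominator gives no ratio; then Cauchy-Schwarz makes the left side vanish. *)
have [nmt0|nmt0] := eqVneq (nm t) 0.
  rewrite nmt0 mul0r mulr0 -amulA; apply: le_trans (cauchy_schwarz _ _) _.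
  by rewrite nmt0 mul0r.
have [nps0|nps0] := eqVneq (np s) 0.
  rewrite nps0 !mulr0; apply: le_trans (cauchy_schwarz _ _) _.
  by rewrite nps0 mulr0.
rewrite -ler_pdivrMr; last first.
  by rewrite mulr_gt0 // lt_neqAle eq_sym ?nmt0 ?nps0 /=.
apply: ub_le_sup; last by exists t, s.
have [M aM] := ito_opnorm_fin itoA (a := a) I.
by exists M => r [u [v [_ _ u0 v0 ->]]]; apply: aM; exists u, v.
Qed.

(** A null element of [A] has a null component in [S] by Pythagoras, while its component in [S'] is
    annihilated by [a] and [star a]. Hence orthogonality to the null elements of [S] extends to
    those of [A]. *)
Lemma d_set_complements : d_set l S `<=` d_set l setT.
Proof.
have [decS S0 S'0 starS starS'] := SS'.
move=> a [[Sa ap] [_ am]]; split; split=> // b [_ b0];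
  have [s [s' [Ss Ss' bE]]] := decS b.
- rewrite bE starD amulDr (S0 a (star s')) ?addr0; auto.
  apply: ap; split=> //; apply: le_anti.
  by rewrite np_ge0 -b0 bE np_complements.
- rewrite bE amulDr (S0 (star a) s') ?addr0; auto.
  apply: am; split=> //; apply: le_anti.
  by rewrite nm_ge0 -b0 bE nm_complements.
Qed.

End Complements.

(** * Closability and density of products *)

Lemma d_set_star a : d_set l setT a -> d_set l setT (star a).
Proof.
move=> [[_ ap] [_ am]]; split; split=> // b [_ b0].
- by apply: am; split; rewrite ?nm_star.
- by rewrite starK -[b]starK; apply: ap; split; rewrite ?np_star.
Qed.

Lemma left_closable_sub (D D' : set A) :
  D `<=` D' -> left_closable l D' -> left_closable l D.
Proof. by move=> DD' clD' a Da; apply: clD' => n; apply/DD'. Qed.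

(** The involution preserves the set d and exchanges the Hilbert semi-norms, so right closability is
    applied to the adjoint sequence. *)
Lemma right_left_closable :
  right_closable l (d_set l setT) -> left_closable l (d_set l setT).
Proof.
move=> clD a Da cp cm ap.
have H (x : nat -> A) : (fun n => np (star (x n))) = (fun n => nm (x n)).
  by apply/funext => n; rewrite np_star.
have H' (x : nat -> A) : (fun n => nm (star (x n))) = (fun n => np (x n)).
  by apply/funext => n; rewrite nm_star.
rewrite -H; apply: (clD (fun n => star (a n))) => [n|||]; last by rewrite H'.
- exact: d_set_star.
- move=> e /cm[N aN]; exists N => m n Nm Nn.
  by rewrite -starB np_star aN.
- move=> e /cp[N aN]; exists N => m n Nm Nn.
  by rewrite -starB nm_star aN.
Qed.

(** Since [(b + c) ** (b' + c')] equals [b ** b' + c ** c'] and [np (b ** b') = 0], each factor can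
    be replaced by its Levy component. *)
Lemma products_dense : complements brownian_part levy_part ->
  forall x, product_span setT x ->
  exists2 z, product_span levy_part z & np (x - z) = 0.
Proof.
move=> [dec BC0 CB0 _ _] x [n [k [u [v [_ ->]]]]].
have /choice[f fP] : forall a, exists c, levy_part c /\ brownian_part (a - c).
  by move=> a; have [b [c [Bb Cc ->]]] := dec a; exists c; rewrite addrK.
have prodE b c b' c' : brownian_part b -> levy_part c ->
    brownian_part b' -> levy_part c' ->
    np ((b + c) ** (b' + c') - c ** c') = 0.
  move=> Bb Cc Bb' Cc'; rewrite amulDl !amulDr (BC0 b c') // (CB0 b' c) //.
  by have [b0 _ _] := Bb; rewrite addr0 add0r addrK (op_eq0P _).1.
exists (\sum_(i < n) k i *: (f (u i) ** f (v i))).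
  exists n, k, (f \o u), (f \o v); split=> // i.
  by split; [have [] := fP (u i)|have [] := fP (v i)].
rewrite -sumrB; elim/big_ind: _ => [||i _]; first exact: np0.
  by move=> y z y0 z0; rewrite -[y]scale1r np_lin0.
have [Cu Bu] := fP (u i); have [Cv Bv] := fP (v i).
rewrite -scalerBr npZ; have := prodE _ _ _ _ Bu Cu Bv Cv.
by rewrite !subrK => ->; rewrite mulr0.
Qed.

(** * Decomposition of an element *)

Lemma square_lt x e : 0 < e -> ip x x < e ^+ 2 -> np x < e.
Proof. by move=> e0; rewrite -np_sqr ltr_pXn2r ?nnegrE // ltW. Qed.

(** * Damping of a self-adjoint element *)

Section Contraction.
Variables (a : A) (s : R).
Hypotheses (star_a : star a = a) (s0 : 0 <= s) (sa : s * op a ^+ 2 <= 1).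

(* [damp n] is left multiplication by [(1 - s a^2)^n]. *)
Definition damp n x := iter n (fun x => x - s%:C *: (a ** (a ** x))) x.

Lemma dampS n x : damp n.+1 x = damp n x - s%:C *: (a ** (a ** damp n x)).
Proof. by []. Qed.

Lemma dampM n x y : damp n (x ** y) = damp n x ** y.
Proof.
by elim: n => // n IHn; rewrite !dampS IHn amulBl amulZl !amulA.
Qed.

Lemma damp_amul n x : damp n (a ** x) = a ** damp n x.
Proof. by elim: n => // n IHn; rewrite !dampS IHn amulBr amulZr. Qed.

Lemma ip_amul x y : ip (a ** x) y = ip x (a ** y).
Proof. by rewrite ip_adj star_a. Qed.

(** For self-adjoint [a] the operator 1 - s a^2 is symmetric, so its powers pass from one argument
    to the other. *)
Lemma ip_damp m n x y : ip (damp m x) (damp n y) = ip x (damp (m + n) y).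
Proof.
elim: m y => // m IHm y; rewrite addSn !dampS !ipE !ip_amul !IHm.
by rewrite -!damp_amul IHm !damp_amul.
Qed.

(** With y = [damp n x], the left side is |y|^2 - 2 s |a y|^2 + s^2 |a^2 y|^2, and s |a|^2 <= 1
    bounds the last term by s |a y|^2. *)
Lemma ip_dampS n x : ip (damp n.+1 x) (damp n.+1 x) <=
  ip (damp n x) (damp n x) - s * ip (a ** damp n x) (a ** damp n x).
Proof.
rewrite dampS; set y := damp n x.
have ipaa : ip (a ** (a ** y)) (a ** (a ** y)) <=
    op a ^+ 2 * ip (a ** y) (a ** y).
  by rewrite -!np_sqr -exprMn ler_pXn2r ?nnegrE ?mulr_ge0 ?np_amul.
rewrite !ipE (ipC y) ip_amul.
set p := ip (a ** y) (a ** y) in ipaa *; set q := ip _ _ in ipaa *.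
have p0 : 0 <= p := ip_ge0 _.
have : s * (s * q) <= s * p.
  rewrite ler_wpM2l //; apply: le_trans (_ : s * (op a ^+ 2 * p) <= _).
    by rewrite ler_wpM2l.
  by rewrite mulrA ler_piMl.
lra.
Qed.

Lemma ip_damp_le m n x : (m <= n)%N ->
  ip (damp n x) (damp n x) <= ip (damp m x) (damp m x).
Proof.
move=> mn; rewrite -(subnKC mn).
elim: (n - m)%N => [|k IHk]; first by rewrite addn0.
rewrite addnS; apply: le_trans IHk; apply: le_trans (ip_dampS _ _) _.
by rewrite gerBl mulr_ge0 ?ip_ge0.
Qed.

(* Each step lowers the square of [norm_p] by at least [s |a x|^2], and
   [a] commutes with [damp], so the losses telescope. *)
Lemma ip_amul_damp n x :
  s * n%:R * ip (a ** damp n x) (a ** damp n x) <= ip x x.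
Proof.
(* The induction needs the remaining squared semi-norm on the left. *)
suff : ip (damp n x) (damp n x) +
    s * n%:R * ip (a ** damp n x) (a ** damp n x) <= ip x x.
  by apply: le_trans; rewrite lerDr ip_ge0.
elim: n => [|n IHn]; first by rewrite mulr0 mul0r addr0.
have := ip_dampS n x.
have : ip (a ** damp n.+1 x) (a ** damp n.+1 x) <=
    ip (a ** damp n x) (a ** damp n x).
  by rewrite -!damp_amul ip_damp_le.
move=> /(ler_wpM2l s0) /(ler_wpM2l (ler0n R n.+1)); move: IHn.
by rewrite -[n.+1%:R]natr1; nra.
Qed.

Lemma damp_comm n : a ** damp n a = damp n a ** a.
Proof. by rewrite -damp_amul dampM. Qed.

Lemma star_damp n : star (damp n a) = damp n a.
Proof.
elim: n => // n IHn.
rewrite dampS starB starZ conj_realC !starM IHn star_a.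
by rewrite -damp_comm -amulA -damp_comm.
Qed.

Lemma damp_product n : exists w, a - damp n a = a ** w.
Proof.
elim: n => [|n [w wE]]; first by exists 0; rewrite subrr amul0r.
exists (w + s%:C *: (a ** damp n a)).
by rewrite dampS opprB addrCA addrC wE amulDr amulZr.
Qed.

Hypothesis s_gt0 : 0 < s.

Lemma damp_op0 e : 0 < e -> exists N, forall n, (N <= n)%N -> op (damp n a) < e.
Proof.
(* For n >= M the bound 1 / (s n) on the squared operator semi-norm is at most (e / 2)^2; the half
   makes the final inequality strict. *)
move=> e0; pose M := (s * (e / 2) ^+ 2)^-1.
have M0 : 0 < s * (e / 2) ^+ 2 by rewrite mulr_gt0 ?exprn_gt0 ?divr_gt0.
have [N MN] : exists N : nat, M <= N%:R.
  by exists (Num.bound M); apply/ltW/archi_boundP; rewrite invr_ge0 ltW.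
exists N => n Nn; apply: (@le_lt_trans _ _ (e / 2)); last first.
  by rewrite ltr_pdivrMr // ltr_pMr // ltr1n.
apply: op_le => [|x]; first by rewrite divr_ge0 // ltW.
apply: np_le; first by rewrite mulr_ge0 // divr_ge0 // ltW.
rewrite -dampM damp_amul exprMn np_sqr.
have Mn : 1 <= n%:R * (s * (e / 2) ^+ 2).
  by rewrite -ler_pdivrMr // mul1r (le_trans MN) // ler_nat.
have := ler_wpM2l (sqr_ge0 (e / 2)) (ip_amul_damp n x).
apply: le_trans; set q := ip (a ** _) _.
have q0 : 0 <= q := ip_ge0 _.
by have := ler_wpM2r q0 Mn; rewrite mul1r; lra.
Qed.

(** At even indices the inner product of the terms m and n is again a squared semi-norm, g (m + n).
    So the squared distance is g (2 m) - 2 g (m + n) + g (2 n), with g decreasing to its infimum. *)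
Lemma damp_cauchy : cauchy_for np (fun n => damp n.*2 a).
Proof.
pose g n := ip (damp n a) (damp n a); pose G := range g.
have infG : has_inf G.
  by split; [exists (g 0%N), 0%N|exists 0 => _ [n _ <-]; apply: ip_ge0].
move=> e e0; have e2 : 0 < e ^+ 2 / 2 by rewrite divr_gt0 ?exprn_gt0.
have [_ [N _ <-] gN] := inf_adherent e2 infG.
have gE m n : ip (damp m.*2 a) (damp n.*2 a) = g (m + n)%N.
  by rewrite /g !ip_damp -!addnn addnACA.
have gle n : (N <= n)%N -> inf G <= g n < inf G + e ^+ 2 / 2.
  move=> Nn; rewrite (le_lt_trans (ip_damp_le _ Nn)) // andbT.
  by apply: ge_inf; [exact: infG.2|exists n].
exists N => m n Nm Nn; apply: square_lt => //.
rewrite !ipE !gE [(n + m)%N]addnC.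
have /andP[_ m1] := gle _ (leq_trans Nm (leq_addr m m)).
have /andP[_ n1] := gle _ (leq_trans Nn (leq_addr n n)).
have /andP[k1 _] := gle _ (leq_trans Nm (leq_addr n m)).
lra.
Qed.

End Contraction.

Lemma selfadjoint_split a : star a = a ->
  exists b, op b = 0 /\ levy_part (a - b).
Proof.
(* The added 1 makes [s] positive even if [op a = 0]. *)
move=> star_a; pose s := (op a ^+ 2 + 1)^-1.
have s1 : 0 < op a ^+ 2 + 1 by rewrite ltr_wpDl ?sqr_ge0.
have s_gt0 : 0 < s by rewrite invr_gt0.
have sa : s * op a ^+ 2 <= 1 by rewrite mulrC ler_pdivrMr // mul1r lerDl.
pose r n := damp a s n.*2 a.
have r_op0 e : 0 < e -> exists N, forall n, (N <= n)%N -> op (r n) < e.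
  move=> e0; have [N rN] := damp_op0 star_a (ltW s_gt0) sa s_gt0 e0.
  by exists N => n Nn; rewrite rN // -addnn (leq_trans Nn) ?leq_addr.
have r_star n : star (r n) = r n := star_damp s star_a _.
have r_np : cauchy_for np r := damp_cauchy star_a (ltW s_gt0) sa.
have r_nm : cauchy_for nm r.
  move=> e /r_np[N rN]; exists N => m n Nm Nn.
  by rewrite -np_star starB !r_star rN.
have r_op : cauchy_for op r.
  move=> e e0; have e2 : 0 < e / 2 by rewrite divr_gt0.
  have [N rN] := r_op0 _ e2; exists N => m n Nm Nn.
  rewrite (le_lt_trans (opD _ _)) // opN [ltRHS]splitr ltrD ?rN //.
have [b rb] := ito_limit r_op r_np r_nm; exists b; split.
  apply: eq0_eps => // e e0; have e2 : 0 < e / 2 by rewrite divr_gt0.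
  have [N1 rN1] := r_op0 _ e2; have [N2 rN2] := rb _ e2.
  have [h _ _] := rN2 (maxn N1 N2) (leq_maxr _ _).
  have := rN1 (maxn N1 N2) (leq_maxl _ _); set n := maxn _ _ in h * => h'.
  rewrite -[b](subKr (r n)) (le_trans (opD _ _)) // opN [leRHS]splitr.
  by rewrite lerD // ltW.
have near e : 0 < e ->
    exists w, [/\ np (a - b - a ** w) < e & nm (a - b - a ** w) < e].
  move=> /rb[N rN]; have [_ np1 nm1] := rN N (leqnn N).
  have [w wE] := damp_product a s N.*2; exists w.
  have -> : a - b - a ** w = r N - b by rewrite -wE opprB addrC addrA subrK.
  by [].
split=> e /near[w [wp wm]].
  by exists (a ** w) => //; apply: product_spanM.
exists (star (a ** w)); last by rewrite -starB np_star.
by rewrite starM; apply: product_spanM.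
Qed.

(** * Elements of zero operator semi-norm *)

(* Orthogonal projection of [v] onto the closure of the left orbit of [v]. *)
Lemma orbit_projection v : exists x : nat -> A,
  cauchy_for np (fun n => x n ** v) /\
  forall z e, 0 < e -> exists N, forall n, (N <= n)%N ->
    `|ip (z ** v) (v - x n ** v)| < e.
Proof.
pose h x := ip (v - x ** v) (v - x ** v).
have infh : has_inf (range h).
  by split; [exists (h 0), 0|exists 0 => _ [x _ <-]; apply: ip_ge0].
have hge x : inf (range h) <= h x by apply: ge_inf; [exact: infh.2|exists x].
(* A minimizing sequence for the distance from [v] to its orbit. *)
have /choice[x xh] : forall n : nat, exists x, h x < inf (range h) + n.+1%:R^-1.
  move=> n; have n0 : 0 < n.+1%:R^-1 :> R by rewrite invr_gt0.
  by have [_ [x _ <-] xn] := inf_adherent n0 infh; exists x.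
have small (e : R) : 0 < e ->
    exists N : nat, forall n, (N <= n)%N -> n.+1%:R^-1 < e.
  move=> e0; exists (Num.bound e^-1) => n Nn.
  rewrite invf_plt ?posrE // (lt_le_trans (archi_boundP _)) ?invr_ge0 ?ltW //.
  by rewrite ltr_nat ltnS.
exists x; split.
  move=> e e0; have e4 : 0 < e ^+ 2 / 4 by rewrite divr_gt0 ?exprn_gt0.
  have [N sN] := small _ e4; exists N => m n Nm Nn; apply: square_lt => //.
  (* Parallelogram law at the midpoint: the squared distance of the two orbit points is at most 2 /
     (m + 1) + 2 / (n + 1). *)
  have := hge ((2^-1)%:C *: (x m + x n)).
  have := xh m; have := xh n; have := sN _ Nm; have := sN _ Nn.
  rewrite /h amulZl amulDl !ipE.
  rewrite !(ipC (x _ ** v) v) !(ipC (x n ** v) (x m ** v)).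
  move: (n.+1%:R^-1) (m.+1%:R^-1) (inf _) => u w G.
  lra.
move=> z e e0; pose q := ip (z ** v) (z ** v).
have q0 : 0 <= q := ip_ge0 _.
(* Moving [x n] by k z changes h by - 2 k p + k^2 q, where p is the inner product to be bounded.
   Near-minimality at k = t and k = - t gives 2 t |p| < 1 / (n + 1) + t^2 q, and both terms are at
   most t e. *)
pose t := e / (q + 1).
have q1 : 0 < q + 1 by rewrite ltr_wpDl.
have t0 : 0 < t by rewrite divr_gt0.
have te : 0 < t * e by rewrite mulr_gt0.
have [N sN] := small _ te; exists N => n Nn.
have tq : t * q <= e.
  by rewrite /t mulrAC ler_pdivrMr // ler_wpM2l ?lerDl // ltW.
have ttq : t * t * q <= t * e by rewrite -mulrA ler_wpM2l // ltW.
have sn := sN _ Nn; have xn := xh n.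
have hp := hge (x n + t%:C *: z); have hm := hge (x n - t%:C *: z).
pose d := v - x n ** v.
have hE k : h (x n + k%:C *: z) = h (x n) - 2 * k * ip (z ** v) d + k * k * q.
  rewrite /h /q amulDl amulZl opprD addrA /d.
  by move: (v - _) (z ** v) => d' w; rewrite !ipE (ipC d' w); ring.
have hE' := hE (- t); rewrite rmorphN scaleNr in hE'.
rewrite hE in hp; rewrite hE' in hm; rewrite -/d.
move: (ip _ d) hp hm => p hp hm.
rewrite ltr_norml; move: (n.+1%:R^-1) (inf _) sn xn hp hm => u G.
move=> sn xn hp hm; by apply/andP; split; rewrite -(ltr_pM2l t0); lra.
Qed.

(** The residue b = v - c is orthogonal to A v, and by continuity to A c. Hence it is orthogonal to
    [star z ** z ** b], whose inner product with b is the square of [np (z ** b)]. *)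
Lemma projection_orthogonal v (x : nat -> A) c :
  (forall z e, 0 < e -> exists N, forall n, (N <= n)%N ->
    `|ip (z ** v) (v - x n ** v)| < e) ->
  (forall e, 0 < e -> exists N, forall n, (N <= n)%N ->
    np (x n ** v - c) < e) ->
  forall z, np (z ** (v - c)) = 0.
Proof.
move=> orth xc; pose b := v - c.
have orthv w : ip (w ** v) b = 0.
  apply: (norm0_eps (M := (1 + np (w ** v)))) => e e0.
  have [N1 h1] := orth w e e0; have [N2 h2] := xc e e0.
  have {}h1 := h1 (maxn N1 N2) (leq_maxl _ _).
  have {}h2 := h2 (maxn N1 N2) (leq_maxr _ _).
  set n := maxn N1 N2 in h1 h2.
  have -> : b = (v - x n ** v) + (x n ** v - c) by rewrite addrA subrK.
  rewrite ipDr (le_trans (ler_normD _ _)) // mulrDl mul1r lerD ?(ltW h1) //.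
  by rewrite (le_trans (ip_le _ _)) // ler_wpM2l // ltW.
have orthc w : ip (w ** c) b = 0.
  apply: (norm0_eps (M := (op w * np b))) => e e0.
  have [N h] := xc e e0; have {}h := h N (leqnn N).
  rewrite -[c](subKr (x N ** v)) amulBr ipDl ipNl amulA orthv add0r normrN.
  rewrite (le_trans (ip_le _ _)) // mulrAC ler_wpM2r //.
  by rewrite (le_trans (np_amul _ _)) // ler_wpM2l // ltW.
move=> z; apply/eqP; rewrite -sqrf_eq0 np_sqr -/b ip_adj ipC.
by rewrite amulA {1}/b amulBr ipDl ipNl orthv orthc subrr.
Qed.

Lemma null_split b : op b = 0 ->
  exists b', brownian_part b' /\ levy_part (b - b').
Proof.
move=> b0; have b0' : op (star b) = 0 by rewrite op_star.
have [x [xcauchy xorth]] := orbit_projection b.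
have [y [ycauchy yorth]] := orbit_projection (star b).
have op0M z v : op v = 0 -> op (z ** v) = 0.
  move=> v0; apply: le_anti.
  by rewrite op_ge0 (le_trans (op_amul _ _)) // v0 mulr0.
have nm0M z v : op v = 0 -> nm (z ** v) = 0.
  move=> v0; apply: le_anti.
  by rewrite nm_ge0 (le_trans (nm_amul _ _)) // v0 mulr0.
have opM0 c : (exists u v, c = u ** b + star (v ** star b)) -> op c = 0.
  move=> [u [v ->]]; apply: le_anti; rewrite op_ge0 (le_trans (opD _ _)) //.
  by rewrite op_star !op0M ?addr0.
have sub u v u' v' :
    u ** b + star (v ** star b) - (u' ** b + star (v' ** star b)) =
    (u - u') ** b + star ((v - v') ** star b).
  by rewrite !amulBl starB opprD addrACA.
have np_sum u v : np (u ** b + star (v ** star b)) <= np (u ** b).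
  by rewrite (le_trans (npD _ _)) // np_star nm0M // addr0.
have nm_sum u v : nm (u ** b + star (v ** star b)) <= np (v ** star b).
  by rewrite (le_trans (nmD _ _)) // nm_star nm0M // add0r.
(* The first summand is null for [op] and [nm], the second for [op] and [np]: each projection is
   seen by one Hilbert semi-norm only. *)
pose c n := x n ** b + star (y n ** star b).
have c_op : cauchy_for op c.
  move=> e e0; exists 0%N => m n _ _; rewrite sub opM0 //.
  by exists (x m - x n), (y m - y n).
have c_np : cauchy_for np c.
  move=> e /xcauchy[N xN]; exists N => m n Nm Nn.
  by rewrite sub (le_lt_trans (np_sum _ _)) // amulBl xN.
have c_nm : cauchy_for nm c.
  move=> e /ycauchy[N yN]; exists N => m n Nm Nn.
  by rewrite sub (le_lt_trans (nm_sum _ _)) // amulBl yN.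
have [d cd] := ito_limit c_op c_np c_nm.
have xd e : 0 < e -> exists N, forall n, (N <= n)%N -> np (x n ** b - d) < e.
  move=> /cd[N dN]; exists N => n /dN[_ h _].
  have -> : x n ** b - d = c n - d - star (y n ** star b).
    by rewrite addrAC addrK.
  by rewrite (le_lt_trans (npB _ _)) // np_star nm0M // addr0.
have yd e : 0 < e ->
    exists N, forall n, (N <= n)%N -> np (y n ** star b - star d) < e.
  move=> /cd[N dN]; exists N => n /dN[_ _ h].
  have -> : y n ** star b - star d = star (c n - d) - star (x n ** b).
    by rewrite starB starD starK addrAC [star (x n ** b) + _]addrC addrK.
  by rewrite (le_lt_trans (npB _ _)) // !np_star nm0M // addr0.
exists (b - d); split; last first.
  rewrite subKr; split=> e e0.
  - have [N /(_ N (leqnn N)) h] := xd e e0; exists (x N ** b).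
      exact: product_spanM.
    by rewrite np_distC.
  - have [N /(_ N (leqnn N)) h] := yd e e0; exists (y N ** star b).
      exact: product_spanM.
    by rewrite np_distC.
split=> [|z|z].
- apply: eq0_eps => // e /cd[N /(_ N (leqnn N))[h _ _]].
  rewrite (le_trans (opD _ _)) // b0 add0r -[d](subKr (c N)) opN.
  rewrite (le_trans (opD _ _)) // opN (opM0 (c N)) ?add0r ?ltW //.
  by exists (x N), (y N).
- exact: projection_orthogonal xorth xd z.
- rewrite -np_star starM starB; exact: projection_orthogonal yorth yd _.
Qed.

(** * The orthogonal sum *)

Lemma brownian_levy_decomposition a :
  exists b c, [/\ brownian_part b, levy_part c & a = b + c].
Proof.
have [_ brownZD _ _] := brownian_part_subalg.
have [_ levyZD _ _] := levy_part_subalg.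
have selfadjoint u : star u = u ->
    exists b c, [/\ brownian_part b, levy_part c & u = b + c].
  move=> /selfadjoint_split[v [v0 uv]]; have [b [Bb vb]] := null_split v0.
  exists b, (1 *: (v - b) + (u - v)); split=> //; first exact: levyZD.
  by rewrite scale1r addrA subrKC addrC subrK.
(* Self-adjoint real and imaginary parts: a = u + i v. *)
pose u := 2^-1 *: (a + star a); pose v := (- 'i / 2) *: (a - star a).
have star_u : star u = u.
  by rewrite starZ starD starK fmorphV rmorph_nat addrC.
have star_v : star v = v.
  rewrite starZ starB starK rmorphM rmorphN /= conjCi opprK fmorphV rmorph_nat.
  by rewrite -[star a - a]opprB scalerN -scaleNr -mulNr.
have [b1 [c1 [Bb1 Cc1 uE]]] := selfadjoint u star_u.
have [b2 [c2 [Bb2 Cc2 vE]]] := selfadjoint v star_v.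
exists ('i *: b2 + b1), ('i *: c2 + c1); split; [exact: brownZD|exact: levyZD|].
rewrite addrACA -scalerDr -vE -uE scalerA mulNr mulrN mulrA -expr2 sqrCi.
rewrite mulN1r opprK addrC -scalerDr addrACA subrr addr0 -mulr2n.
by rewrite -[a *+ 2]scaler_nat scalerA mulVf ?scale1r // pnatr_eq0.
Qed.

Lemma brownian_levy_complements : complements brownian_part levy_part.
Proof.
have [_ _ _ Bstar] := brownian_part_subalg.
have [_ _ _ Cstar] := levy_part_subalg.
split=> //; first exact: brownian_levy_decomposition.
- by move=> b c; apply: mul_brownian_levy.
- by move=> b c; apply: mul_levy_brownian.
Qed.

Lemma levy_brownian_complements : complements levy_part brownian_part.
Proof.
have [dec BC CB Bstar Cstar] := brownian_levy_complements; split=> //.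
- by move=> a; have [b [c [Bb Cc ->]]] := dec a; exists c, b; rewrite addrC.
- by move=> c b Cc Bb; apply: CB.
- by move=> c b Cc Bb; apply: BC.
Qed.

Lemma levy_part_dense_p : dense_for np (product_span levy_part) levy_part.
Proof.
move=> c [cP _] e /cP[z Pz cz].
have [w Pw zw] := products_dense brownian_levy_complements Pz.
exists w => //; rewrite -(subrK z c) -addrA (le_lt_trans (npD _ _)) //.
by rewrite zw addr0.
Qed.

Lemma levy_part_dense_m : dense_for nm (product_span levy_part) levy_part.
Proof.
have [_ _ _ Cstar] := levy_part_subalg.
move=> c /Cstar Cc e /(levy_part_dense_p Cc)[z Pz cz]; exists (star z).
  exact: product_span_star.
by rewrite -np_star starB starK.
Qed.

End Decomposition.

Theorem theorem3 (R : realType) (A : starAlgType R[i])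
    (theta : A) (l : {scalar A})
    (hA : ito_bstar theta l [set: A])
    (hclos : left_closable l (d_set l [set: A]) \/
             right_closable l (d_set l [set: A])) :
  exists B C : set A,
    [/\ quantum_brownian theta l B,
        quantum_levy theta l C,
        (forall b, B b -> opnorm l B b = opnorm l [set: A] b) /\
        (forall c, C c -> opnorm l C c = opnorm l [set: A] c),
        forall a, exists b c, [/\ B b, C c & a = b + c] &
        forall b c, B b -> C c -> b ** c = 0].
Proof.
have BC := brownian_levy_complements hA.
have CB := levy_brownian_complements hA.
have opB := opS_complements hA BC; have opC := opS_complements hA CB.
have clA : left_closable l (d_set l setT).
  by case: hclos => // /(right_left_closable hA).
exists (brownian_part l), (levy_part l); split.
- split; last by move=> b Bb; rewrite opB //; case: Bb.
  + apply: (ito_bstar_sub hA) => //.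
    * exact: brownian_part_subalg hA.
    * exact: brownian_part_theta hA.
    * exact: brownian_part_closed hA.
  + exact: left_closable_sub (d_set_complements hA BC) clA.
- split.
  + apply: (ito_bstar_sub hA) => //.
    * exact: levy_part_subalg hA.
    * exact: levy_part_theta hA.
    * exact: levy_part_closed hA.
  + exact: left_closable_sub (d_set_complements hA CB) clA.
  + exact: levy_part_dense_p hA.
  + exact: levy_part_dense_m hA.
- by [].
- exact: brownian_levy_decomposition hA.
- by move=> b c; apply: mul_brownian_levy hA _ _.
Qed.
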